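(* Let $k\ge1$ be a fixed integer, let $\xi$ be a real random variable with $\mathbb E\xi=0$, $\mathbb E\xi^2=1$ and $\mathbb E\exp(t_0\xi^2)<\infty$ for some $t_0>0$, and suppose $p=p_n$ satisfies $p/\log n\to\infty$ as $n\to\infty$. Then $$\frac{T_{n,k}}{p}\longrightarrow1\qquad\text{in probability as }n\to\infty.$$
   Context: $X=X_n=(\xi_{ij})_{1\le i\le p,\,1\le j\le n}\in\mathbb R^{p\times n}$ has i.i.d. entries that are copies of $\xi$. For $S\subset[n]=\{1,\dots,n\}$, $X_{[S]}$ is the submatrix formed by the columns indexed by $S$, and $$T_{n,k}:=\max_{S\subset[n],\,|S|=k}\lambda_{\max}\big(X_{[S]}^\top X_{[S]}\big).$$ *)

(* Defs.v *)
From mathcomp Require Import all_boot all_order all_algebra.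
From mathcomp Require Import all_classical all_reals all_analysis.

Set Implicit Arguments.
Unset Strict Implicit.
Unset Printing Implicit Defensive.

Import Order.TTheory GRing.Theory Num.Theory numFieldNormedType.Exports.

Local Open Scope classical_set_scope.
Local Open Scope ring_scope.

(* The two laws are compared on Borel sets only: outside the sigma-algebra a
   measure of the library is an unconstrained set function. *)
Definition same_law (R : realType)
    (d1 : measure_display) (T1 : measurableType d1) (P1 : probability T1 R)
    (X1 : {RV P1 >-> R})
    (d2 : measure_display) (T2 : measurableType d2) (P2 : probability T2 R)
    (X2 : {RV P2 >-> R}) : Prop :=
  forall B : set R, measurable B -> P1 (X1 @^-1` B) = P2 (X2 @^-1` B).

Definition mutually_independent (R : realType) (d : measure_display)
    (T : measurableType d) (P : probability T R) (I : finType)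
    (X : I -> {RV P >-> R}) : Prop :=
  forall (J : {set I}) (B : I -> set R),
    (forall i, i \in J -> measurable (B i)) ->
    P (\bigcap_(i in [set` J]) (X i @^-1` B i)) =
    (\prod_(i in J) P (X i @^-1` B i))%E.

(* The limit is a constant, so the n-th variable may live on its own
   probability space.  The definition is meant for measurable Y n. *)
Definition cvg_in_probability (R : realType) (d : nat -> measure_display)
    (T : forall n, measurableType (d n)) (P : forall n, probability (T n) R)
    (Y : forall n, T n -> R) (c : R) : Prop :=
  forall eps : R, 0 < eps ->
    P n [set w | eps < `|Y n w - c|] @[n --> \oo] --> 0%E.

Definition random_matrix (R : realType) (d : measure_display)
    (T : measurableType d) (P : probability T R) (p n : nat)
    (X : 'I_p -> 'I_n -> {RV P >-> R}) (w : T) : 'M[R]_(p, n) :=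
  \matrix_(i < p, j < n) X i j w.

(* The real spectrum is finite, and it is nonempty when A is symmetric of
   positive size, so that this supremum is then the largest eigenvalue. *)
Definition lambda_max (R : realType) (m : nat) (A : 'M[R]_m) : R :=
  sup [set a : R | eigenvalue A a].

(* The columns indexed by S are listed in increasing order. *)
Definition col_submatrix (R : realType) (p n : nat) (A : 'M[R]_(p, n))
    (S : {set 'I_n}) : 'M[R]_(p, #|S|) :=
  colsub (fun j : 'I_#|S| => enum_val j) A.

(* A supremum over finitely many S, hence a maximum as soon as k <= n; for
   k > n there is no S and sup set0 = 0. *)
Definition max_gram_eig (R : realType) (p n k : nat) (A : 'M[R]_(p, n)) : R :=
  sup [set lambda_max ((col_submatrix A S)^T *m col_submatrix A S)
      | S in [set S : {set 'I_n} | #|S| = k]].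

(* Main.v *)
From HB Require Import structures.
Require Import Defs.
From mathcomp Require Import all_boot all_order all_algebra.
From mathcomp Require Import all_classical all_reals all_analysis.
From mathcomp Require Import measurable_realfun complex ring lra.

Import Order.TTheory GRing.Theory Num.Theory numFieldNormedType.Exports.

Local Open Scope classical_set_scope.
Local Open Scope ring_scope.

Set Implicit Arguments.
Unset Strict Implicit.
Unset Printing Implicit Defensive.

(** Write X_j for the j-th column.  The k by k matrix of inner products X_i . X_j
    with i, j in S should be close to p times the identity, uniformly in S, and
    then so are its eigenvalues.

    - By Gershgorin ([gershgorin]), if |X_i . X_j - p [i = j]| <= delta p for all
      pairs of columns, every eigenvalue of every k-column Gram matrix lies within
      k delta p of p; since a symmetric matrix has a real eigenvalue
      ([symmetric_eigenvalue_exists]), so does the maximum over S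
      ([max_gram_eig_close]).
    - For a fixed pair, X_i . X_j - p [i = j] is a sum over the p rows of
      independent centered variables.  They are dominated by squares of entries,
      so they have a finite exponential moment, their moment generating
      function is at most exp (c t^2) near the origin
      ([integral_expR_centered_le]), and the Chernoff bound gives a tail
      2 exp (- r p) with r > 0 depending only on delta and the law of the
      entries ([centered_product_tail]).
    - There are n^2 pairs and p / log n tends to infinity, so the union bound
      n^2 2 exp (- r p) is eventually at most 2 / n.

    The deviation probabilities are only meaningful on measurable events.
    An eigenvalue above c is detected by countably many conditions on
    determinants at rational points, which makes the largest
    eigenvalue a random variable ([measurable_max_gram_eig]).  Independence is
    given on events; [integral_prod_indep] carries it over to products of
    functions of pairs of entries. *)

(** * Eigenvalues of real symmetric matrices *)

(** Over R[i] the characteristic polynomial has a root z; pairing its eigenvector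
    v with the conjugate of v gives z |v|^2 = z^* |v|^2, so z is real. *)
Lemma symmetric_eigenvalue_exists (R : rcfType) (m : nat) (A : 'M[R]_m) :
  (0 < m)%N -> A^T = A -> exists a, eigenvalue A a.
Proof.
case: m A => // m A _ symA.
pose AC : 'M[R[i]]_m.+1 := map_mx (real_complex R) A.
have /closed_rootP[z] : size (char_poly AC) != 1%N by rewrite size_char_poly.
rewrite -eigenvalue_root_char => /eigenvalueP[v vA v0].
have cAC : map_mx Num.conj AC = AC.
  apply/matrixP => i j; rewrite !mxE.
  by apply: conj_Creal; rewrite complex_real eqxx.
pose w := map_mx Num.conj v.
have wA : w *m AC = z^* *: w by rewrite -[AC]cAC -map_mxM vA map_mxZ.
have symAC : AC^T = AC by rewrite /AC map_trmx symA.
have : z *: (v *m w^T) = z^* *: (v *m w^T).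
  rewrite scalemxAl -vA -mulmxA -{1}symAC -trmx_mul wA.
  by rewrite [(_ *: w)^T]linearZ /= scalemxAr.
move/matrixP/(_ 0 0); rewrite !mxE.
set q := \sum_j _ => zq.
have q0 : q != 0.
  have [j vj0] : exists j, v 0 j != 0 by apply/rV0Pn.
  rewrite /q psumr_neq0 => [|i _]; rewrite ?mxE; last exact: mul_conjC_ge0.
  by apply/hasP; exists j; rewrite ?mem_index_enum // !mxE mul_conjC_gt0.
have /mulIf : q != 0 by [].
move/(_ _ _ zq)/esym/CrealP => zR.
move: zR => /complex_realP[x zx]; exists x.
have : eigenvalue AC z by apply/eigenvalueP; exists v.
by rewrite zx !eigenvalue_root_char /AC -map_char_poly fmorph_root.
Qed.

(** At the coordinate where an eigenvector is largest in absolute value, the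
    equation v (A - b) = (a - b) v bounds a - b by the sum of a column of A - b. *)
Lemma gershgorin (R : realFieldType) (m : nat) (A : 'M[R]_m) (a b e : R) :
  (forall i j, `|A i j - b *+ (i == j)| <= e) -> eigenvalue A a ->
  `|a - b| <= m%:R * e.
Proof.
move=> Ae /eigenvalueP[v vA /rV0Pn[j0 vj0]].
have [i _ vmax] := arg_maxP (fun j => `|v 0 j|) (erefl : xpredT j0).
have vi0 : 0 < `|v 0 i| by rewrite (lt_le_trans _ (vmax j0 _)) ?normr_gt0.
rewrite -(ler_pM2r vi0) -normrM mulrBl.
have -> : a * v 0 i - b * v 0 i = \sum_j v 0 j * (A j i - b *+ (j == i)).
  under eq_bigr do rewrite mulrBr.
  rewrite sumrB; congr (_ - _).
    by move/matrixP: vA => /(_ 0 i); rewrite !mxE.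
  rewrite (bigD1 i) //= big1 => [|j /negPf ->]; last by rewrite mulr0.
  by rewrite eqxx addr0 mulrC.
apply: (le_trans (ler_norm_sum _ _ _)).
have -> : m%:R * e * `|v 0 i| = \sum_(j < m) `|v 0 i| * e.
  by rewrite sumr_const card_ord -mulrA mulr_natl mulrC.
by apply: ler_sum => j _; rewrite normrM; apply: ler_pM => //; exact: vmax.
Qed.

(** * Measurability of the largest eigenvalue *)

(** A continuous function has a zero on a compact interval as soon as it takes
    arbitrarily small values there, and rational points suffice to see them.
    The intervals [c + 1/(K+1), K] exhaust the open half-line above c. *)
Lemma zero_gt_rat (R : realType) (f : R -> R) (c : R) : continuous f ->
  (exists2 a, f a = 0 & c < a) <->
  exists K : nat, forall l : nat, exists r : rat,
    [/\ c + K.+1%:R^-1 <= ratr r, ratr r <= (K%:R : R) &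
        `|f (ratr r)| < (l.+1%:R^-1 : R)].
Proof.
move=> cf; split=> [[a fa0 ca]|[K HK]].
  have [K [K1 K2]] : exists K : nat, c + K.+1%:R^-1 < a /\ a < (K%:R : R).
    near \oo => K; exists K; split.
      rewrite -ltrBrDl; near: K.
      by apply: near_infty_natSinv_lt (PosNum (_ : 0 < a - c)); rewrite subr_gt0.
    by near: K; exact: nbhs_infty_gtr.
  exists K => l.
  have /dense_rat : open (`]c + K.+1%:R^-1, K%:R[%classic `&`
      [set x | `|f x| < l.+1%:R^-1]).
    apply: openI; first exact: interval_open.
    apply: (@open_comp _ _ (fun x => `|f x|) [set x : R | x < l.+1%:R^-1]).
      move=> x _; apply: (@continuous_comp _ _ _ f (fun y : R => `|y|)); first exact: cf.
      exact: norm_continuous.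
    exact: open_lt.
  have ne : (`]c + K.+1%:R^-1, K%:R[%classic `&`
      [set x | `|f x| < l.+1%:R^-1]) !=set0.
    by exists a; rewrite /= in_itv /= K1 K2 fa0 normr0 invr_gt0.
  move/(_ ne) => [x [[/=]]]; rewrite in_itv /= => /andP[r1 r2] r3 [r _ rE].
  by exists r; rewrite rE; split => //; exact: ltW.
have cKK : c + K.+1%:R^-1 <= K%:R.
  by have [r [r1 r2 _]] := HK 0%N; exact: le_trans r2.
have cnf : {within `[c + K.+1%:R^-1, K%:R], continuous (fun x => `|f x|)}.
  apply: continuous_subspaceT => x.
  apply: (@continuous_comp _ _ _ f (fun y : R => `|y|)); first exact: cf.
  exact: norm_continuous.
have [a aI amin] := EVT_min cKK cnf.
exists a; last first.
  move: aI; rewrite in_itv /= => /andP[+ _]; apply: lt_le_trans.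
  by rewrite ltrDl invr_gt0.
apply/eqP; rewrite -normr_eq0 eq_le normr_ge0 andbT leNgt; apply/negP => fa0.
near \oo => l.
have [r [r1 r2]] := HK l; apply/negP; rewrite -leNgt.
apply: le_trans (amin (ratr r) _); last by rewrite in_itv /= r1.
by apply: ltW; near: l; apply: near_infty_natSinv_lt (PosNum fa0).
Unshelve. all: by end_near. Qed.

Lemma char_poly_hornerE (R : comNzRingType) (m : nat) (A : 'M[R]_m) (x : R) :
  (char_poly A).[x] = \det (x%:M - A).
Proof.
rewrite /char_poly -[LHS]/(horner_eval x _) -det_map_mx; congr (\det _).
apply/matrixP => i j; rewrite !mxE /= /horner_eval.
by rewrite hornerD hornerN hornerMn hornerX hornerC.
Qed.

Lemma measurable_det d (T : measurableType d) (R : realType) (m : nat)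
    (A : T -> 'M[R]_m) :
  (forall i j, measurable_fun setT (fun w => A w i j)) ->
  measurable_fun setT (fun w => \det (A w)).
Proof.
move=> mA; apply: measurable_sum => s; apply: measurable_funM => //.
by apply: measurable_prod => i _; exact: mA.
Qed.

Lemma measurable_eigenvalue_gt d (T : measurableType d) (R : realType) (m : nat)
    (A : T -> 'M[R]_m) (c : R) :
  (forall i j, measurable_fun setT (fun w => A w i j)) ->
  measurable [set w | exists2 a, eigenvalue (A w) a & c < a].
Proof.
move=> mA.
have -> : [set w | exists2 a, eigenvalue (A w) a & c < a] =
  \bigcup_K \bigcap_l \bigcup_(r : rat)
    [set w | [/\ c + K.+1%:R^-1 <= ratr r, ratr r <= (K%:R : R) &
        `|\det ((ratr r)%:M - A w)| < (l.+1%:R^-1 : R)]].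
  apply/seteqP; split=> w /=.
    move=> [a aE ca].
    have [||K HK] := (@zero_gt_rat _ (horner (char_poly (A w))) c _).1.
    - exact: continuous_horner.
    - by exists a => //; apply/eqP; move: aE; rewrite eigenvalue_root_char.
    exists K => // l _; have [r] := HK l.
    by rewrite char_poly_hornerE; exists r.
  move=> [K _ HK].
  have [||a a0 ca] := (@zero_gt_rat _ (horner (char_poly (A w))) c _).2.
  - exact: continuous_horner.
  - exists K => l; have [r _ rE] := HK l I; exists r.
    by rewrite char_poly_hornerE.
  - by exists a => //; rewrite eigenvalue_root_char; apply/eqP.
apply: bigcupT_measurable => K; apply: bigcapT_measurable => l.
apply: bigcupT_measurable_rat => r.
have [h|h] := boolP ((c + K.+1%:R^-1 <= ratr r) && (ratr r <= (K%:R : R)));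
    last first.
  (* An inadmissible r contributes the empty event. *)
  rewrite (_ : [set _ | _] = set0) //; apply/seteqP; split=> // w [] /= h1 h2.
  by move: h; rewrite h1 h2.
rewrite (_ : [set _ | _] = setT `&` (fun w => `|\det ((ratr r)%:M - A w)|) @^-1`
    `]-oo, l.+1%:R^-1[%classic); last first.
  move/andP: h => [h1 h2].
  by apply/seteqP; split=> w /=; rewrite in_itv /= => -[].
suff : measurable_fun setT (fun w => `|\det ((ratr r)%:M - A w)|).
  by apply => //; exact: measurable_itv.
apply: measurableT_comp => //; apply: measurable_det => i j.
have -> : (fun w => ((ratr r)%:M - A w) i j) =
  (fun w => ((ratr r)%:M : 'M[R]_m) i j - A w i j).
  by apply/funext => w; rewrite !mxE.
by apply: measurable_funB => //.
Qed.

(** * The largest eigenvalue over the column submatrices *)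

Lemma sup_dist_le (R : realType) (E : set R) (b e : R) : E !=set0 ->
  (forall x, E x -> `|x - b| <= e) -> `|sup E - b| <= e.
Proof.
move=> [x Ex] Eb.
have ubE : ubound E (b + e).
  by move=> y /Eb; rewrite ler_distl => /andP[].
rewrite ler_distl; apply/andP; split; last by apply: ge_sup => //; exists x.
have /= := Eb x Ex; rewrite ler_distl => /andP[h _]; apply: (le_trans h).
by apply: ub_le_sup => //; exists (b + e).
Qed.

(** The form in which both suprema, over the spectrum and over the sets S, are
    turned into countable or finite unions of events. *)
Lemma lt_supP (R : realType) (E : set R) (c : R) : has_sup E ->
  c < sup E <-> exists2 x, E x & c < x.
Proof.
move=> supE; split=> [|[x Ex cx]].
  by case: supE => E0 _; exact: sup_gt.
by apply: (lt_le_trans cx); apply: ub_le_sup => //; case: supE.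
Qed.

Lemma has_sup_eigenvalue (R : realType) (m : nat) (A : 'M[R]_m) :
  (0 < m)%N -> A^T = A -> has_sup [set a : R | eigenvalue A a].
Proof.
move=> m0 symA; split; first exact: symmetric_eigenvalue_exists.
exists (m%:R * \sum_i \sum_j `|A i j|) => a /= /(@gershgorin _ _ _ _ 0).
move=> /(_ (\sum_i \sum_j `|A i j|)); rewrite subr0 => Aa.
apply: (le_trans (ler_norm _)); apply: Aa => i j.
rewrite mul0rn subr0 (bigD1 i) //= (bigD1 j) //= -addrA lerDl addr_ge0 //.
  by apply: sumr_ge0.
by apply: sumr_ge0 => u _; apply: sumr_ge0.
Qed.

Section gram.
Variables (R : realType) (p n k : nat).
Implicit Types (A : 'M[R]_(p, n)) (S : {set 'I_n}).

Definition gram A S : 'M[R]_#|S| := (col_submatrix A S)^T *m col_submatrix A S.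

Lemma gram_sym A S : (gram A S)^T = gram A S.
Proof. by rewrite /gram trmx_mul trmxK. Qed.

Lemma gramE A S i j :
  gram A S i j = \sum_l A l (enum_val i) * A l (enum_val j).
Proof. by rewrite !mxE; apply: eq_bigr => l _; rewrite !mxE. Qed.

Lemma has_sup_max_gram A : (k <= n)%N ->
  has_sup [set lambda_max (gram A S) | S in [set S : {set 'I_n} | #|S| = k]].
Proof.
move=> kn; split.
  have [S Sk] : exists S : {set 'I_n}, #|S| = k.
    exists [set i : 'I_n | (i < k)%N]%SET.
    rewrite cardsE -sum1_card (big_ord_narrow kn) sum1_card card_ord //.
  by exists (lambda_max (gram A S)); exists S.
exists (\sum_(S : {set 'I_n}) `|lambda_max (gram A S)|) => _ [S _ <-].
by rewrite (bigD1 S) //= (le_trans (ler_norm _)) // lerDl sumr_ge0.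
Qed.

Lemma max_gram_eig_close A (b e : R) : (0 < k)%N -> (k <= n)%N ->
  (forall i j, `|\sum_l A l i * A l j - b *+ (i == j)| <= e) ->
  `|max_gram_eig k A - b| <= k%:R * e.
Proof.
move=> k0 kn Ae; apply: sup_dist_le; first by have [] := has_sup_max_gram A kn.
move=> _ [S Sk <-]; rewrite -/(gram A S).
apply: sup_dist_le.
  by apply: symmetric_eigenvalue_exists (gram_sym A S); rewrite Sk.
move=> a /= aE; rewrite -[in k%:R]Sk; apply: gershgorin aE => i j.
by rewrite gramE -(inj_eq enum_val_inj).
Qed.

End gram.

Lemma measurable_max_gram_eig d (T : measurableType d) (R : realType)
    (p n k : nat) (A : T -> 'M[R]_(p, n)) : (0 < k)%N -> (k <= n)%N ->
  (forall i j, measurable_fun setT (fun w => A w i j)) ->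
  measurable_fun setT (fun w => max_gram_eig k (A w)).
Proof.
move=> k0 kn mA; apply: (measurability _ (RGenOInfty.measurableE R)).
move=> _ [_ [c ->] <-]; rewrite setTI.
have -> : (fun w => max_gram_eig k (A w)) @^-1` `]c, +oo[%classic =
  \bigcup_(S in [set S : {set 'I_n} | #|S| = k])
    [set w | exists2 a, eigenvalue (gram (A w) S) a & c < a].
  have lamP w (S : {set 'I_n}) : #|S| = k -> c < lambda_max (gram (A w) S) <->
      exists2 a, eigenvalue (gram (A w) S) a & c < a.
    move=> Sk; apply: lt_supP; apply: has_sup_eigenvalue; first by rewrite Sk.
    exact: gram_sym.
  apply/seteqP; split=> w /=; rewrite in_itv /= andbT.
    move=> /(lt_supP _ (has_sup_max_gram (A w) kn))[_ [S Sk <-]].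
    by move=> /(lamP _ _ Sk); exists S.
  move=> [S Sk] /(lamP _ _ Sk) cS.
  apply/(lt_supP _ (has_sup_max_gram (A w) kn)).
  by exists (lambda_max (gram (A w) S)) => //; exists S.
apply: fin_bigcup_measurable => [|S Sk]; first exact: finite_finset.
apply: measurable_eigenvalue_gt => i j.
under eq_fun do rewrite gramE.
by apply: measurable_sum => l; apply: measurable_funM.
Qed.

(** * Independence and integrals of products *)

Section weighted_laws.
Context d d' (T : measurableType d) (E : measurableType d') (R : realType)
  (mu : {measure set T -> \bar R}) (Y : T -> E).
Hypothesis mY : measurable_fun setT Y.
Local Open Scope ereal_scope.

Let mY1 C : measurable C -> measurable (Y @^-1` C).
Proof. by move=> mC; rewrite -[X in measurable X]setTI; exact: mY. Qed.

Let in_preim w (C : set E) : (w \in Y @^-1` C) = (Y w \in C).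
Proof. by apply/idP/idP; rewrite !inE. Qed.

Import HBNNSimple.

(** The right-hand side depends on Z only through its integrals over the sets
    Y @^-1` C: this is what reduces functions of Y to events. *)
Lemma integral_comp_weighted_approx (Z : T -> R) (f : E -> R)
    (mf : measurable_fun setT (EFin \o f)) :
  measurable_fun setT Z -> (forall w, 0 <= Z w)%R -> (forall y, 0 <= f y)%R ->
  \int[mu]_w (f (Y w) * Z w)%:E =
  limn (fun n => \sum_(r \in range (nnsfun_approx measurableT mf n))
    r%:E * \int[mu]_(w in Y @^-1` (nnsfun_approx measurableT mf n @^-1` [set r]))
      (Z w)%:E).
Proof.
move=> mZ Z0 f0; pose f_ := nnsfun_approx measurableT mf.
transitivity (limn (fun n => \int[mu]_w (f_ n (Y w) * Z w)%:E)).
  rewrite -monotone_convergence//.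
  - apply: eq_integral => w _; apply/esym/cvg_lim => //.
    rewrite EFinM; under eq_fun do rewrite EFinM.
    apply: cvgeMr => //.
    apply: (@cvg_nnsfun_approx _ _ _ _ measurableT _ mf _ (Y w)) => // y _.
    by rewrite lee_fin.
  - move=> n; apply/measurable_EFinP/measurable_funM => //.
    exact: measurableT_comp.
  - by move=> n w _; rewrite lee_fin mulr_ge0.
  - move=> w _ m n mn; rewrite lee_fin ler_wpM2r //.
    exact/lefP/nd_nnsfun_approx.
congr (limn _); apply/funext => n.
transitivity (\int[mu]_w (\sum_(r \in range (f_ n))
    (r * \1_(f_ n @^-1` [set r]) (Y w) * Z w)%:E)).
  apply: eq_integral => w _; rewrite fimfunE EFinM -fsumEFin// ge0_mule_fsuml//.
  by move=> r; rewrite nnfun_muleindic_ge0.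
have m1 r : measurable_fun setT (fun w => \1_(f_ n @^-1` [set r]) (Y w) : R).
  by apply: measurableT_comp => //; exact: measurable_indic.
rewrite ge0_integral_fsum//.
- apply: eq_fsbigr => r /[!inE] -[y _ ry].
  under eq_integral do rewrite -mulrA EFinM.
  rewrite ge0_integralZl//.
  + congr (_ * _); rewrite [RHS]integral_mkcond; apply: eq_integral => w _.
    by rewrite patchE indicE in_preim; case: ifP => _; rewrite ?mul1r ?mul0r.
  + by apply/measurable_EFinP/measurable_funM.
  + by move=> w _; rewrite lee_fin mulr_ge0.
  + by rewrite lee_fin -ry.
- move=> r; apply/measurable_EFinP/measurable_funM => //.
  exact: measurable_funM.
- by move=> r w _; rewrite EFinM mule_ge0 ?nnfun_muleindic_ge0 ?lee_fin.
Qed.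

(** Two densities that give Y the same weighted law on a generating
    pi-system give every nonnegative function of Y the same integral. *)
Lemma integral_comp_weighted_eq (G : set (set E)) (Z1 Z2 : T -> R) (f : E -> R) :
  @measurable _ E = <<s G >> -> setI_closed G -> G setT ->
  measurable_fun setT Z1 -> (forall w, 0 <= Z1 w)%R ->
  measurable_fun setT Z2 -> (forall w, 0 <= Z2 w)%R ->
  \int[mu]_w (Z1 w)%:E < +oo ->
  (forall C, G C ->
    \int[mu]_w (\1_C (Y w) * Z1 w)%:E = \int[mu]_w (\1_C (Y w) * Z2 w)%:E) ->
  measurable_fun setT f -> (forall y, 0 <= f y)%R ->
  \int[mu]_w (f (Y w) * Z1 w)%:E = \int[mu]_w (f (Y w) * Z2 w)%:E.
Proof.
move=> GE GI GT mZ1 Z10 mZ2 Z20 fin1 eqG mf f0.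
pose nu (Z : T -> R) C := \int[mu]_(w in Y @^-1` C) (Z w)%:E.
have nuE Z C : \int[mu]_w (\1_C (Y w) * Z w)%:E = nu Z C.
  rewrite /nu [RHS]integral_mkcond; apply: eq_integral => w _.
  by rewrite patchE indicE in_preim; case: ifP => _; rewrite ?mul1r ?mul0r.
have nu0 Z : nu Z set0 = 0 by rewrite /nu preimage_set0 integral_set0.
have nu_ge0 (Z : T -> R) (Z0 : forall w, (0 <= Z w)%R) C : 0 <= nu Z C.
  by apply: integral_ge0 => w _; rewrite lee_fin.
have nu_sigma (Z : T -> R) (mZ : measurable_fun setT Z) (Z0 : forall w, (0 <= Z w)%R) :
    semi_sigma_additive (nu Z).
  move=> F mF tF mUF; rewrite /nu preimage_bigcup.
  rewrite [X in _ --> X]ge0_integral_bigcup//.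
  - apply: is_cvg_nneseries => i _ _; exact: nu_ge0.
  - by move=> i; exact: mY1.
  - by apply/measurable_EFinP; exact: measurable_funTS.
  - by move=> w _; rewrite lee_fin.
  - by move=> i j _ _ [w [Fi Fj]]; apply: tF => //; exists (Y w).
pose m1 : {measure set E -> \bar R} := HB.pack (nu Z1)
  (isMeasure.Build _ _ _ (nu Z1) (nu0 Z1) (nu_ge0 Z1 Z10) (nu_sigma Z1 mZ1 Z10)).
pose m2 : {measure set E -> \bar R} := HB.pack (nu Z2)
  (isMeasure.Build _ _ _ (nu Z2) (nu0 Z2) (nu_ge0 Z2 Z20) (nu_sigma Z2 mZ2 Z20)).
have m12 C : measurable C -> nu Z1 C = nu Z2 C.
  apply: (@measure_unique _ _ _ G (fun=> setT) GE GI _ _ m1 m2) => //.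
  - by rewrite bigcup_const//; exists 0%N.
  - by move=> A GA; rewrite /= -!nuE eqG.
have mfE : measurable_fun setT (EFin \o f) by exact/measurable_EFinP.
rewrite !(integral_comp_weighted_approx mfE)//.
congr (limn _); apply/funext => n; apply: eq_fsbigr => r _.
by congr (_ * _); exact: m12.
Qed.

End weighted_laws.

Section product_rule.
Context d d' (T : measurableType d) (E : measurableType d') (R : realType)
  (P : probability T R) (I : finType) (Y : I -> T -> E) (G : set (set E)).
Hypothesis mY : forall i, measurable_fun setT (Y i).
Hypothesis GE : @measurable _ E = <<s G >>.
Hypothesis GI : setI_closed G.
Hypothesis GT : G setT.
Hypothesis indep : forall C : I -> set E, (forall i, G (C i)) ->
  P (\bigcap_i (Y i @^-1` C i)) = (\prod_i P (Y i @^-1` C i))%E.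
Local Open Scope ereal_scope.

(** Indicators of sets of G are replaced by arbitrary functions one index at a
    time: with all other factors fixed as a density, the law of Y m is determined
    by its values on G. *)
Lemma integral_prod_indep (g : I -> E -> R) (r : I -> R) :
  (forall i, measurable_fun setT (g i)) -> (forall i y, 0 <= g i y)%R ->
  (forall i, \int[P]_w (g i (Y i w))%:E = (r i)%:E) ->
  \int[P]_w (\prod_i g i (Y i w))%:E = (\prod_i r i)%:E.
Proof.
have mG C : G C -> measurable C.
  by move=> GC; rewrite GE; exact: sub_sigma_algebra.
have mY1 i C : G C -> measurable (Y i @^-1` C).
  by move=> /mG mC; rewrite -[X in measurable X]setTI; exact: mY.
have int1 i C : G C -> \int[P]_w (\1_C (Y i w))%:E = (fine (P (Y i @^-1` C)))%:E.
  move=> GC; rewrite fineK ?fin_num_measure//; last exact: mY1.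
  rewrite -[X in _ = P X]setIT -integral_indic//; last exact: mY1.
move=> mg g0 gr.
(* s lists the indices whose factor need not be an indicator. *)
suff : forall (s : seq I) (g : I -> E -> R) (r : I -> R),
    (forall i, measurable_fun setT (g i)) -> (forall i y, 0 <= g i y)%R ->
    (forall i, \int[P]_w (g i (Y i w))%:E = (r i)%:E) ->
    (forall i, i \notin s -> exists2 C, G C & g i = \1_C) ->
    \int[P]_w (\prod_i g i (Y i w))%:E = (\prod_i r i)%:E.
  by move=> /(_ (enum I) g r); apply => // i; rewrite mem_enum.
elim=> [|m s IH] {mg g0 gr}g {}r mg g0 gr gs.
  have /choice[C GC] : forall i, exists C, G C /\ g i = \1_C.
    by move=> i; have [//|C] := gs i; exists C.
  transitivity (\int[P]_w (\1_(\bigcap_i (Y i @^-1` C i)) w)%:E).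
    apply: eq_integral => w _; congr EFin; rewrite indicE.
    under eq_bigr do rewrite (GC _).2 indicE.
    have [wC|wC] := boolP (w \in _).
      rewrite big1// => i _; move: wC; rewrite inE => /(_ i Logic.I) /= Cw.
      by rewrite mem_set.
    have [i Ci] : exists i, Y i w \notin C i.
      apply/not_existsP => h; move/negP: wC; apply; rewrite inE => i _ /=.
      by move/negP: (h i); rewrite negbK inE.
    by rewrite (bigD1 i)//= (negPf Ci) mul0r.
  rewrite integral_indic//; last first.
    by apply: fin_bigcap_measurable => // i _; apply: mY1; exact: (GC i).1.
  rewrite setIT; apply: (etrans (indep (fun i => (GC i).1))).
  rewrite -prodEFin; apply: eq_bigr => i _.
  by rewrite -gr (GC i).2 int1 ?fineK ?fin_num_measure//; [apply: mY1|]; exact: (GC i).1.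
pose Z w := (\prod_(i | i != m) g i (Y i w))%R.
pose c := (\prod_(i | i != m) r i)%R.
have mZ : measurable_fun setT Z.
  rewrite /Z; under eq_fun do rewrite big_mkcond.
  apply: measurable_prod => i _; case: (i != m) => //; exact: measurableT_comp.
have Z0 w : (0 <= Z w)%R by apply: prodr_ge0.
have c0 : (0 <= c)%R.
  apply: prodr_ge0 => i _; rewrite -lee_fin -gr integral_ge0// => w _.
  by rewrite lee_fin.
have ZC C : G C ->
    \int[P]_w (\1_C (Y m w) * Z w)%:E = \int[P]_w (\1_C (Y m w) * cst c w)%:E.
  move=> GC.
  (* The constant c stands for the density Z: both give Y m the same weighted
     law, by the induction hypothesis for the indicator of C at m. *)
  have := IH (fun i => if i == m then \1_C else g i)
    (fun i => if i == m then fine (P (Y m @^-1` C)) else r i).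
  rewrite (bigD1 m)//= eqxx [X in (_ * X)%:E](eq_bigr r); last first.
    by move=> i /negPf ->.
  rewrite -/c => IHC.
  transitivity ((fine (P (Y m @^-1` C)) * c)%:E).
    rewrite -IHC; first last.
    - move=> i si; case: ifP => [_|im]; first by exists C.
      by apply: gs; rewrite inE im.
    - by move=> i; case: ifP => [/eqP ->|_]; [exact: int1|exact: gr].
    - by move=> i y; case: ifP => _; [rewrite indicE|exact: g0].
    - by move=> i; case: ifP => _; [apply: measurable_indic; exact: mG|exact: mg].
    apply: eq_integral => w _; congr EFin.
    rewrite (bigD1 m)//= eqxx; congr (_ * _)%R.
    by apply: eq_bigr => i /negPf ->.
  under eq_integral do rewrite mulrC EFinM.
  rewrite ge0_integralZl ?lee_fin//.
  - by rewrite int1// muleC.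
  - apply/measurable_EFinP; apply: measurableT_comp => //.
    by apply: measurable_indic; exact: mG.
have finZ : \int[P]_w (Z w)%:E < +oo.
  have := ZC _ GT; under eq_integral do rewrite indicT mul1r.
  move=> ->; under eq_integral do rewrite indicT mul1r.
  rewrite [ltLHS](integral_cst P measurableT c%:E).
  by rewrite [X in (_ * X)%E](@probability_setT _ _ _ P) mule1 ltry.
transitivity (\int[P]_w (g m (Y m w) * Z w)%:E).
  by apply: eq_integral => w _; rewrite (bigD1 m).
rewrite (integral_comp_weighted_eq (mY m) GE GI GT mZ Z0 _ _ finZ ZC)//.
transitivity (\int[P]_w (c%:E * (g m (Y m w))%:E)).
  by apply: eq_integral => w _; rewrite -EFinM mulrC.
rewrite ge0_integralZl ?lee_fin//.
- by rewrite gr -EFinM mulrC (bigD1 m).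
- by apply/measurable_EFinP; exact: measurableT_comp.
- by move=> w _; rewrite lee_fin.
Qed.

End product_rule.

Definition rectangles (R : realType) : set (set (R * R)) :=
  [set A `*` B | A in measurable & B in measurable].

Section column_pairs.
Context (R : realType) (d : measure_display) (T : measurableType d)
  (P : probability T R) (p n : nat) (X : 'I_p -> 'I_n -> {RV P >-> R}).
Hypothesis X_indep :
  mutually_independent (fun ij : 'I_p * 'I_n => X ij.1 ij.2).

(** Both sides expand, by independence of all entries, into the same product
    over the entries of the matrix; taking i = j covers the squares. *)
Lemma rectangles_indep (i j : 'I_n) (C : 'I_p -> set (R * R)) :
  (forall l, @rectangles R (C l)) ->
  P (\bigcap_l ((fun w => (X l i w, X l j w)) @^-1` C l)) =
  (\prod_l P ((fun w => (X l i w, X l j w)) @^-1` C l))%E.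
Proof.
move=> rC.
have /choice[AB ABP] : forall l, exists ab : set R * set R,
    [/\ measurable ab.1, measurable ab.2 & ab.1 `*` ab.2 = C l].
  by move=> l; have [A mA [B mB AB]] := rC l; exists (A, B).
(* When i = j both conditions fall on the same entry, hence the intersection. *)
pose D (lm : 'I_p * 'I_n) : set R :=
  (if lm.2 == i then (AB lm.1).1 else setT) `&` (if lm.2 == j then (AB lm.1).2 else setT).
have mD lm : measurable (D lm).
  have [mA mB _] := ABP lm.1.
  by apply: measurableI; case: ifP.
have rowE l : (fun w => (X l i w, X l j w)) @^-1` C l =
    \bigcap_m (X l m @^-1` D (l, m)).
  have [_ _ <-] := ABP l; apply/seteqP; split=> w /=.
    by move=> [Aw Bw] m _; split=> /=; case: eqP => // ->.
  by move=> h; split; [have [+ _] := h i I|have [_ +] := h j I]; rewrite /= eqxx.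
have rowP l : P ((fun w => (X l i w, X l j w)) @^-1` C l) =
    (\prod_m P (X l m @^-1` D (l, m)))%E.
  rewrite rowE.
  have := @X_indep [set (l, m) | m : 'I_n]%SET D (fun lm _ => mD lm).
  rewrite big_imset/=; last by move=> m1 m2 _ _ [].
  rewrite [X in _ = X -> _](eq_bigl xpredT)// => <-; congr (P _).
  apply/seteqP; split=> w /= h.
    by move=> lm /= /imsetP[m _ ->]; exact: h.
  by move=> m _; apply: (h (l, m)) => /=; exact: imset_f.
rewrite [RHS](eq_bigr _ (fun l _ => rowP l)) pair_big/=.
have := @X_indep [set: 'I_p * 'I_n]%SET D (fun lm _ => mD lm).
rewrite [X in _ = X -> _](eq_bigl xpredT)/=; last by move=> lm; rewrite !inE.
move=> E; transitivity (\prod_(i0 : 'I_p * 'I_n) P (X i0.1 i0.2 @^-1` D i0))%E; last first.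
  by apply: eq_bigr => -[].
rewrite -E; congr (P _); apply/seteqP; split=> w /= h.
  by move=> [l m] _ /=; move: (h l I); rewrite rowE; apply.
by move=> l _; rewrite rowE => m _; apply: (h (l, m)) => /=; rewrite inE.
Qed.

End column_pairs.

Section independent_pair.
Context d (T : measurableType d) (R : realType) (P : probability T R)
  (U V : T -> R).
Hypotheses (mU : measurable_fun setT U) (mV : measurable_fun setT V).
Hypothesis UV_indep : forall A B, measurable A -> measurable B ->
  P (U @^-1` A `&` V @^-1` B) = (P (U @^-1` A) * P (V @^-1` B))%E.

Lemma integral_mul_indep (f h : R -> R) (a b : R) :
  measurable_fun setT f -> (forall x, 0 <= f x) ->
  measurable_fun setT h -> (forall x, 0 <= h x) ->
  (\int[P]_w (f (U w))%:E = a%:E)%E -> (\int[P]_w (h (V w))%:E = b%:E)%E ->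
  (\int[P]_w (f (U w) * h (V w))%:E = (a * b)%:E)%E.
Proof.
move=> mf f0 mh h0 fa hb.
have := @integral_prod_indep _ _ T _ R P bool (fun c => if c then U else V)
  measurable _ _ _ _ _ (fun c => if c then f else h) (fun c => if c then a else b).
rewrite big_bool/=; under eq_integral do rewrite big_bool/=.
apply.
- by case.
- by rewrite sigma_algebra_id//; exact: sigma_algebra_measurable.
- by move=> A B; exact: measurableI.
- exact: measurableT.
- move=> C mC; rewrite big_bool/= -UV_indep//; congr (P _).
  apply/seteqP; split=> w /=; last by move=> [? ?] [].
  by move=> h1; split; [exact: (h1 true)|exact: (h1 false)].
- by case.
- by case.
- by case.
Qed.

(** Splitting both factors into positive and negative parts reduces the signed
    product to the nonnegative case: the four resulting integrals are equal and
    cancel in pairs. *)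
Lemma integral_mul_indep_centered (a b : R) :
  (\int[P]_w (Num.max (U w) 0)%:E = a%:E)%E ->
  (\int[P]_w (Num.max (- U w) 0)%:E = a%:E)%E ->
  (\int[P]_w (Num.max (V w) 0)%:E = b%:E)%E ->
  (\int[P]_w (Num.max (- V w) 0)%:E = b%:E)%E ->
  (\int[P]_w (U w * V w)%:E = 0)%E.
Proof.
pose pos (x : R) := Num.max x 0; pose neg (x : R) := Num.max (- x) 0.
have mpos : measurable_fun setT pos by exact: measurable_maxr.
have mneg : measurable_fun setT neg by apply: measurable_maxr => //; exact: measurable_funN.
have pos0 x : 0 <= pos x by rewrite le_max lexx orbT.
have neg0 x : 0 <= neg x by rewrite le_max lexx orbT.
move=> Up Un Vp Vn.
have int4 (f h : R -> R) : measurable_fun setT f -> (forall x, 0 <= f x) ->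
    measurable_fun setT h -> (forall x, 0 <= h x) ->
    (\int[P]_w (f (U w))%:E = a%:E)%E -> (\int[P]_w (h (V w))%:E = b%:E)%E ->
    P.-integrable setT (fun w => (f (U w) * h (V w))%:E) /\
    (\int[P]_w (f (U w) * h (V w))%:E = (a * b)%:E)%E.
  move=> mf f0 mh h0 fa hb; have E := integral_mul_indep mf f0 mh h0 fa hb.
  split=> //; apply/integrableP; split.
    by apply/measurable_EFinP; apply: measurable_funM; exact: measurableT_comp.
  under eq_integral do rewrite gee0_abs ?lee_fin ?mulr_ge0//.
  by rewrite E ltry.
have [ipp pp] := int4 _ _ mpos pos0 mpos pos0 Up Vp.
have [inn nn] := int4 _ _ mneg neg0 mneg neg0 Un Vn.
have [ipn pn] := int4 _ _ mpos pos0 mneg neg0 Up Vn.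
have [inp np] := int4 _ _ mneg neg0 mpos pos0 Un Vp.
have posneg x : x = pos x - neg x.
  by rewrite /pos /neg; have [x0|x0] := leP x 0; have [y0|y0] := leP (- x) 0; lra.
transitivity (\int[P]_w (((pos (U w) * pos (V w))%:E + (neg (U w) * neg (V w))%:E)
    - ((pos (U w) * neg (V w))%:E + (neg (U w) * pos (V w))%:E)))%E.
  apply: eq_integral => w _; rewrite -!EFinD; congr EFin.
  by rewrite {1}(posneg (U w)) {1}(posneg (V w)); ring.
rewrite integralB//; [|exact: integrableD|exact: integrableD].
by rewrite !integralD// pp nn pn np subee.
Qed.

End independent_pair.

(** * Exponential moments and tail bounds *)

Section exponential_bounds.
Variable R : realType.
Implicit Types x y s t : R.

(** Both signs follow from exp x <= 1 + x exp x, which is 1 - x <= exp (- x). *)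
Lemma expR_le_quadratic x : expR x <= 1 + x + x ^+ 2 * expR `|x|.
Proof.
have h1 : expR x <= 1 + x * expR x.
  have : (1 - x) * expR x <= 1.
    by rewrite -ler_pdivlMr ?expR_gt0// div1r -expRN expR_ge1Dx.
  by rewrite mulrBl mul1r lerBlDr.
have x2 : 0 <= x ^+ 2 by exact: sqr_ge0.
apply: (le_trans h1); have [x0|x0] := leP 0 x.
  rewrite ger0_norm// -addrA lerD2l expr2 -mulrA -[X in X + _]mulr1 -mulrDr.
  by rewrite ler_wpM2l.
have h2 : x * expR x <= x + x ^+ 2.
  by rewrite -[X in X + _]mulr1 expr2 -mulrDr ler_nM2l// expR_ge1Dx.
rewrite -addrA lerD2l (le_trans h2)// lerD2l -[leLHS]mulr1 ler_wpM2l//.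
by rewrite -[leLHS]expR0 ler_expR.
Qed.

Lemma sqr_le_expR y s : 0 < s -> y ^+ 2 <= 16 / s ^+ 2 * expR (s * `|y| / 2).
Proof.
move=> s0; have z0 : 0 <= s * `|y| / 4 by rewrite divr_ge0 ?mulr_ge0// ltW.
have : (s * `|y| / 4) ^+ 2 <= expR (s * `|y| / 4) ^+ 2.
  rewrite lerXn2r ?nnegrE ?expR_ge0// (le_trans _ (expR_ge1Dx _))//.
  by rewrite lerDr.
rewrite -expRM_natl.
have -> : 2 * (s * `|y| / 4) = s * `|y| / 2 by field.
rewrite -[y ^+ 2](real_normK (num_real y)).
have s2 : 0 < s ^+ 2 by rewrite exprn_gt0.
rewrite -[16 / _ * _]mulrC mulrA ler_pdivlMr//.
by rewrite !exprMn; lra.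
Qed.

(** Half of the exponent s |y| pays for the factor exp |t y|, the other half for
    the factor y^2 of the second-order remainder. *)
Lemma expR_tilt_le y s t : 0 < s -> `|t| <= s / 2 ->
  expR (t * y) <= 1 + t * y + t ^+ 2 * (16 / s ^+ 2) * expR (s * `|y|).
Proof.
move=> s0 ts; apply: (le_trans (expR_le_quadratic _)); rewrite lerD2l.
rewrite exprMn -[leLHS]mulrA -[leRHS]mulrA ler_wpM2l ?sqr_ge0//.
have -> : s * `|y| = s * `|y| / 2 + s * `|y| / 2 by field.
rewrite expRD [leRHS]mulrA; apply: ler_pM => //; first exact: sqr_ge0.
- exact: sqr_le_expR.
by rewrite ler_expR normrM; have := ler_wpM2r (normr_ge0 y) ts; lra.
Qed.

(** From |xy| <= (x^2 + y^2) / 2, and then the arithmetic-geometric mean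
    inequality for the exponentials.  The bound is pointwise, so it applies to
    the square of one entry as well as to a product of two. *)
Lemma expR_centered_prod_le x y s (b : bool) : 0 <= s ->
  expR (s * `|x * y - b%:R|) <=
  expR s / 2 * (expR (s * x ^+ 2) + expR (s * y ^+ 2)).
Proof.
move=> s0.
have h : `|x * y - b%:R| <= 1 + (x ^+ 2 + y ^+ 2) / 2.
  rewrite (le_trans (ler_normB _ _))// [leLHS]addrC lerD//.
    by rewrite normr_nat; case: b; rewrite ?lexx ?ler01.
  rewrite normrM -(real_normK (num_real x)) -(real_normK (num_real y)).
  by have := sqr_ge0 (`|x| - `|y|); rewrite sqrrB; lra.
have -> : expR s / 2 * (expR (s * x ^+ 2) + expR (s * y ^+ 2)) =
    expR s * ((expR (s * x ^+ 2 / 2) ^+ 2 + expR (s * y ^+ 2 / 2) ^+ 2) / 2).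
  rewrite -!expRM_natl.
  have dbl z : 2 * (s * z ^+ 2 / 2) = s * z ^+ 2 by field.
  by rewrite !dbl; field.
apply: (@le_trans _ _ (expR s * (expR (s * x ^+ 2 / 2) * expR (s * y ^+ 2 / 2)))).
  rewrite -!expRD ler_expR; have := ler_wpM2l s0 h; lra.
rewrite ler_wpM2l ?expR_ge0//.
by have := sqr_ge0 (expR (s * x ^+ 2 / 2) - expR (s * y ^+ 2 / 2)); rewrite sqrrB; lra.
Qed.

End exponential_bounds.

Lemma centered_pos_neg_parts d (T : measurableType d) (R : realType)
    (P : probability T R) (f : T -> R) : measurable_fun setT f ->
  (\int[P]_w (f w ^+ 2)%:E < +oo)%E -> (\int[P]_w (f w)%:E = 0)%E ->
  exists a : R, (\int[P]_w (Num.max (f w) 0)%:E = a%:E)%E /\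
    (\int[P]_w (Num.max (- f w) 0)%:E = a%:E)%E.
Proof.
move=> mf f2 f0.
have mf2 : measurable_fun setT (fun w => f w ^+ 2) by exact: measurable_funX.
have i2 : P.-integrable setT (fun w => (f w ^+ 2)%:E).
  apply/integrableP; split; first exact/measurable_EFinP.
  by under eq_integral do rewrite gee0_abs ?lee_fin ?sqr_ge0//.
have i1 : P.-integrable setT (fun=> 1%E : \bar R) by exact: finite_measure_integrable_cst.
have bounded (h : T -> R) : measurable_fun setT h ->
    (forall w, `|h w| <= `|f w|) -> P.-integrable setT (EFin \o h).
  move=> mh hf.
  apply: (@le_integrable _ _ _ _ _ _ _ (fun w => 1 + (f w ^+ 2)%:E)%E) => //.
  - exact/measurable_EFinP.
  - move=> w _ /=; rewrite lee_fin (le_trans (hf w))// [leRHS]ger0_norm ?addr_ge0 ?sqr_ge0//.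
    rewrite -(real_normK (num_real (f w))).
    by have := sqr_ge0 (`|f w| - 1); rewrite sqrrB; have := normr_ge0 (f w); nra.
  - exact: integrableD.
have ip : P.-integrable setT (EFin \o (fun w => Num.max (f w) 0)).
  apply: bounded => [|w]; first exact: measurable_maxr.
  by rewrite maxEle; case: ifP => _; rewrite ?normr0.
have im : P.-integrable setT (EFin \o (fun w => Num.max (- f w) 0)).
  apply: bounded => [|w]; first by apply: measurable_maxr => //; exact: measurable_funN.
  by rewrite maxEle; case: ifP => _; rewrite ?normr0 ?normrN.
have fp := integral_fune_fin_num measurableT ip.
have fm := integral_fune_fin_num measurableT im.
have E : (\int[P]_w (Num.max (f w) 0)%:E - \int[P]_w (Num.max (- f w) 0)%:E = 0)%E.
  rewrite -integralB// -f0; apply: eq_integral => w _ /=; congr EFin.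
  by have [x0|x0] := leP (f w) 0; have [y0|y0] := leP (- f w) 0; lra.
exists (fine (\int[P]_w (Num.max (f w) 0)%:E)); rewrite fineK//; split=> //.
move: E; rewrite -(fineK fp) -(fineK fm) -EFinB => -[/eqP].
by rewrite subr_eq0 => /eqP ->.
Qed.

Lemma same_law_integral (R : realType)
    (d1 : measure_display) (T1 : measurableType d1) (P1 : probability T1 R)
    (X1 : {RV P1 >-> R})
    (d2 : measure_display) (T2 : measurableType d2) (P2 : probability T2 R)
    (X2 : {RV P2 >-> R}) (f : R -> R) :
  same_law X1 X2 -> measurable_fun setT f -> (forall x, 0 <= f x) ->
  (\int[P1]_w (f (X1 w))%:E = \int[P2]_w (f (X2 w))%:E)%E.
Proof.
move=> XX mf f0.
have mX1 : measurable_fun setT X1 by [].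
have mX2 : measurable_fun setT X2 by [].
transitivity (\int[pushforward P1 X1]_x (f x)%:E)%E.
  rewrite ge0_integral_pushforward//; last by move=> x _; rewrite lee_fin.
  exact/measurable_EFinP.
transitivity (\int[pushforward P2 X2]_x (f x)%:E)%E.
  by apply: eq_measure_integral => B mB _; exact: XX.
rewrite ge0_integral_pushforward//; last by move=> x _; rewrite lee_fin.
exact/measurable_EFinP.
Qed.

Section probability_bounds.
Context d (T : measurableType d) (R : realType) (P : probability T R).
Local Open Scope ereal_scope.

Lemma integrable_le_expR (Y : T -> R) (s K : R) :
  measurable_fun setT Y -> (0 < s)%R ->
  \int[P]_w (expR (s * `|Y w|))%:E <= K%:E ->
  P.-integrable setT (EFin \o (fun w => expR (s * `|Y w|)%R)) /\
  P.-integrable setT (EFin \o Y).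
Proof.
move=> mY s0 eK.
have me : measurable_fun setT (fun w => expR (s * `|Y w|))%R.
  apply: measurableT_comp => //; apply: measurable_funM => //.
  exact: measurableT_comp.
have ie : P.-integrable setT (EFin \o (fun w => expR (s * `|Y w|)%R)).
  apply/integrableP; split; first exact/measurable_EFinP.
  under eq_integral do rewrite gee0_abs ?lee_fin ?expR_ge0//.
  exact: le_lt_trans eK (ltry _).
split=> //; apply: (@le_integrable _ _ _ _ _ _ _
    (fun w => s^-1%:E * (EFin \o (fun w => expR (s * `|Y w|)%R)) w)) => //.
- exact/measurable_EFinP.
- move=> w _ /=; rewrite lee_fin [leRHS]ger0_norm; last first.
    by rewrite mulr_ge0 ?expR_ge0 ?invr_ge0 ?(ltW s0).
  rewrite -ler_pdivrMl ?invr_gt0// invrK.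
  by rewrite (le_trans _ (expR_ge1Dx _))// lerDr.
- exact: integrableZl.
Qed.

(** The first-order term of the exponential integrates to zero, so the moment
    generating function is flat to second order at the origin. *)
Lemma integral_expR_centered_le (Y : T -> R) (s t K : R) :
  measurable_fun setT Y -> (0 < s)%R -> (`|t| <= s / 2)%R ->
  \int[P]_w (expR (s * `|Y w|))%:E <= K%:E -> \int[P]_w (Y w)%:E = 0 ->
  \int[P]_w (expR (t * Y w))%:E <= (expR (t ^+ 2 * (16 / s ^+ 2) * K))%:E.
Proof.
move=> mY s0 ts eK Y0; have [ie iY] := integrable_le_expR mY s0 eK.
set c := (t ^+ 2 * (16 / s ^+ 2))%R.
have c0 : (0 <= c)%R by rewrite mulr_ge0 ?sqr_ge0 ?divr_ge0 ?sqr_ge0.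
have i1 : P.-integrable setT (fun=> 1%E : \bar R) by exact: finite_measure_integrable_cst.
pose h w := 1 + t%:E * (EFin \o Y) w +
  c%:E * (EFin \o (fun w => expR (s * `|Y w|)%R)) w.
have itY := integrableZl measurableT t iY.
have ice := integrableZl measurableT c ie.
apply: (@le_trans _ _ (\int[P]_w h w)).
  apply: ge0_le_integral => //.
  - apply/measurable_EFinP; apply: measurableT_comp => //.
    exact: measurable_funM.
  - by apply: emeasurable_funD; [apply: emeasurable_funD => //|];
      exact: (measurable_int P).
  - by move=> w _; rewrite /h /= -!EFinM -!EFinD lee_fin expR_tilt_le.
rewrite /h integralD//=; last exact: integrableD.
rewrite integralD//= integralZl//= Y0 mule0 adde0 integralZl//=.
rewrite integral_cst// mul1e [X in X + _](@probability_setT _ _ _ P).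
apply: (@le_trans _ _ (1 + c%:E * K%:E)).
  by rewrite leeD2l// lee_wpmul2l// lee_fin.
by rewrite -EFinM -EFinD lee_fin expR_ge1Dx.
Qed.

End probability_bounds.

Lemma chernoff_two_sided d (T : measurableType d) (R : realType)
    (P : probability T R) (S : T -> R) (t x b : R) :
  measurable_fun setT S -> 0 < t ->
  (forall u, `|u| = t -> (\int[P]_w (expR (u * S w))%:E <= (expR b)%:E)%E) ->
  (P [set w | x < `|S w|]%R <= (2 * expR (b - t * x))%:E)%E.
Proof.
move=> mS t0 bS.
have half (e : R) : `|e| = 1 ->
    (P [set w | x <= e * S w]%R <= (expR (b - t * x))%:E)%E.
  move=> e1.
  have meS : measurable_fun setT (fun w => e * S w) by exact: measurable_funM.
  pose eS : {RV P >-> R} :=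
    HB.pack (fun w => e * S w) (isMeasurableFun.Build _ _ _ _ _ meS).
  have H := @chernoff _ _ _ P eS t x t0; apply: (le_trans H).
  rewrite expRD EFinM lee_wpmul2r ?lee_fin ?expR_ge0//.
  rewrite /mmt_gen_fun unlock.
  have := bS (t * e); rewrite normrM e1 mulr1 gtr0_norm// => /(_ erefl).
  congr (_ <= _)%E; apply: eq_integral => w _ /=; congr (expR _)%:E; ring.
have mx (e : R) : measurable [set w | x <= e * S w].
  rewrite (_ : mkset _ =
    setT `&` (fun w => e * S w) @^-1` `[x, +oo[%classic); last first.
    by rewrite setTI; apply/seteqP; split=> w /=; rewrite in_itv /= andbT.
  have meS : measurable_fun setT (fun w => e * S w) by exact: measurable_funM.
  by apply: meS => //; exact: measurable_itv.
have mS1 : measurable [set w | x < `|S w|].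
  rewrite (_ : mkset _ =
    setT `&` (fun w => `|S w|) @^-1` `]x, +oo[%classic); last first.
    by rewrite setTI; apply/seteqP; split=> w /=; rewrite in_itv /= andbT.
  have meS : measurable_fun setT (fun w => `|S w|) by exact: measurableT_comp.
  by apply: meS => //; exact: measurable_itv.
apply: (@le_trans _ _ (P ([set w | x <= 1 * S w] `|` [set w | x <= -1 * S w]))).
  apply: le_measure; rewrite ?inE//; first exact: measurableU.
  move=> w /= /ltW; rewrite mul1r mulN1r ler_normr => /orP[]; by [left|right].
apply: (le_trans (measureU2 _ _ _)) => //.
rewrite mulr_natl mulr2n EFinD; apply: leeD; apply: half; first exact: normr1.
by rewrite normrN1.
Qed.

(** * Concentration of the Gram matrix *)

Section entry_products.
Context (R : realType) (d0 : measure_display) (T0 : measurableType d0)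
  (P0 : probability T0 R) (xi : {RV P0 >-> R}).
Context (d : measure_display) (T : measurableType d) (P : probability T R)
  (p n : nat) (X : 'I_p -> 'I_n -> {RV P >-> R}).
Hypothesis X_law : forall i j, same_law (X i j) xi.
Hypothesis X_indep :
  mutually_independent (fun ij : 'I_p * 'I_n => X ij.1 ij.2).
Hypothesis xi_mean : (\int[P0]_w (xi w)%:E = 0)%E.
Hypothesis xi_var : (\int[P0]_w (xi w ^+ 2)%:E = 1)%E.
Variables t0 K : R.
Hypothesis t0_gt0 : 0 < t0.
Hypothesis xi_exp : (\int[P0]_w (expR (t0 * xi w ^+ 2))%:E = K%:E)%E.

Definition centered_product (i j : 'I_n) (l : 'I_p) (w : T) : R :=
  X l i w * X l j w - (i == j)%:R.
Local Notation Z := centered_product.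

Lemma measurable_centered_product i j l : measurable_fun setT (Z i j l).
Proof. by apply: measurable_funB => //; exact: measurable_funM. Qed.

Let sqr_integral l i : (\int[P]_w (X l i w ^+ 2)%:E = 1)%E.
Proof.
rewrite -xi_var; apply: (same_law_integral (f := fun x => x ^+ 2)) => //.
by move=> x; exact: sqr_ge0.
Qed.

Let product_integral l i j : i != j -> (\int[P]_w (X l i w * X l j w)%:E = 0)%E.
Proof.
move=> ij.
have [a [ap am]] : exists a : R, (\int[P0]_w (Num.max (xi w) 0)%:E = a%:E)%E /\
    (\int[P0]_w (Num.max (- xi w) 0)%:E = a%:E)%E.
  by apply: centered_pos_neg_parts => //; rewrite xi_var ltry.
have mm : measurable_fun setT (fun x : R => Num.max (- x) 0).
  by apply: measurable_maxr => //; exact: measurable_funN.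
have mp : measurable_fun setT (fun x : R => Num.max x 0) by exact: measurable_maxr.
have Xp m : (\int[P]_w (Num.max (X l m w) 0)%:E = a%:E)%E.
  by rewrite (same_law_integral (X_law l m) mp)// => x; rewrite le_max lexx orbT.
have Xm m : (\int[P]_w (Num.max (- X l m w) 0)%:E = a%:E)%E.
  by rewrite (same_law_integral (X_law l m) mm)// => x; rewrite le_max lexx orbT.
apply: (integral_mul_indep_centered _ _ _ (Xp i) (Xm i) (Xp j) (Xm j)) => //.
move=> A B mA mB.
have := @X_indep [set (l, i); (l, j)]%SET (fun lm => if lm.2 == i then A else B).
have lij : (l, i) != (l, j) by apply: contra ij => /eqP[->].
rewrite big_setU1 ?inE//= big_set1/= eqxx [j == i]eq_sym (negPf ij) => <-; last first.
  by move=> lm _; case: ifP.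
congr (P _); apply/seteqP; split=> w /= h.
  by move=> lm /=; rewrite !inE => /orP[] /eqP -> /=;
    rewrite ?eqxx 1?eq_sym ?(negPf ij); case: h.
split; first by have := h (l, i); rewrite /= !inE !eqxx; apply.
by have := h (l, j); rewrite /= !inE !eqxx orbT eq_sym (negPf ij); apply.
Qed.

Lemma integral_expR_centered_product i j l :
  (\int[P]_w (expR (t0 * `|Z i j l w|))%:E <= (expR t0 * K)%:E)%E.
Proof.
have me : measurable_fun setT (fun x : R => expR (t0 * x ^+ 2)).
  by apply: measurableT_comp => //; exact: measurable_funM.
have eX m : (\int[P]_w (expR (t0 * X l m w ^+ 2))%:E = K%:E)%E.
  by rewrite (same_law_integral (X_law l m) me).
have meX m : measurable_fun setT (fun w => (expR (t0 * X l m w ^+ 2))%:E).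
  by apply/measurable_EFinP; exact: (measurableT_comp me).
apply: (@le_trans _ _ (\int[P]_w ((expR t0 / 2)%:E *
    ((expR (t0 * X l i w ^+ 2))%:E + (expR (t0 * X l j w ^+ 2))%:E)))%E).
  apply: ge0_le_integral => //.
  - apply/measurable_EFinP; apply: measurableT_comp => //.
    apply: measurable_funM => //; apply: measurableT_comp => //.
    exact: measurable_centered_product.
  - by apply: measurable_funeM; apply: emeasurable_funD.
  - move=> w _; rewrite -EFinD -EFinM lee_fin.
    by apply: expR_centered_prod_le; exact: ltW.
rewrite ge0_integralZl ?lee_fin ?divr_ge0 ?expR_ge0//; last 2 first.
- by apply: emeasurable_funD.
- by move=> w _; rewrite -EFinD lee_fin addr_ge0 ?expR_ge0.
rewrite ge0_integralD// !eX -EFinD -EFinM lee_fin.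
by rewrite le_eqVlt; apply/orP; left; apply/eqP; field.
Qed.

Lemma integral_centered_product i j l : (\int[P]_w (Z i j l w)%:E = 0)%E.
Proof.
have [_ iZ] := integrable_le_expR (measurable_centered_product i j l) t0_gt0
  (integral_expR_centered_product i j l).
have i1 : P.-integrable setT (fun=> (i == j)%:R%:E : \bar R).
  exact: finite_measure_integrable_cst.
have iXX : P.-integrable setT (fun w => (X l i w * X l j w)%:E).
  apply: eq_integrable (integrableD measurableT iZ i1) => // w _ /=.
  by rewrite -EFinD subrK.
under eq_integral do rewrite EFinB.
rewrite integralB// integral_cst// [X in (_ * X)%E](@probability_setT _ _ _ P) mule1.
have [->|ij] := eqVneq i j.
  under eq_integral do rewrite -expr2.
  by rewrite sqr_integral -EFinB subrr.
by rewrite product_integral// sub0e oppe0.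
Qed.

Let c := 16 / t0 ^+ 2 * (expR t0 * K).

(** Rows are independent, so the exponential moment of the sum over the rows is
    the product of exponential moments. *)
Lemma integral_expR_sum_centered_product i j (t : R) : `|t| <= t0 / 2 ->
  (\int[P]_w (expR (t * \sum_l Z i j l w))%:E <= (expR (p%:R * (t ^+ 2 * c)))%:E)%E.
Proof.
move=> tt0.
pose h (x : R * R) := expR (t * (x.1 * x.2 - (i == j)%:R)).
have mh : measurable_fun setT h.
  apply: measurableT_comp => //; apply: measurable_funM => //.
  by apply: measurable_funB => //; exact: measurable_funM.
have rle l : (\int[P]_w (h (X l i w, X l j w))%:E <= (expR (t ^+ 2 * c))%:E)%E.
  rewrite /c mulrA; apply: (integral_expR_centered_le (measurable_centered_product i j l)
    t0_gt0 tt0 (integral_expR_centered_product i j l)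
    (integral_centered_product i j l)).
have r0 l : (0 <= \int[P]_w (h (X l i w, X l j w))%:E)%E.
  by apply: integral_ge0 => w _; rewrite lee_fin expR_ge0.
have rfin l : (\int[P]_w (h (X l i w, X l j w))%:E)%E \is a fin_num.
  by rewrite ge0_fin_numE// (le_lt_trans (rle l))// ltry.
have -> : (\int[P]_w (expR (t * \sum_l Z i j l w))%:E =
    \int[P]_w (\prod_l h (X l i w, X l j w))%:E)%E.
  by apply: eq_integral => w _; rewrite mulr_sumr expR_sum.
rewrite (@integral_prod_indep _ _ T _ R P 'I_p (fun l w => (X l i w, X l j w))
  (@rectangles R) _ _ _ _ _ (fun=> h)
  (fun l => fine (\int[P]_w (h (X l i w, X l j w))%:E)%E)) => [|l|||||||].
- rewrite lee_fin expRM_natl -[p in leRHS]card_ord -prodr_const.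
  apply: ler_prod => l _; rewrite fine_ge0//=.
  by rewrite -lee_fin fineK.
- exact: measurable_fun_pair.
- exact: measurable_prod_measurableType.
- move=> _ _ [A1 mA1 [B1 mB1 <-]] [A2 mA2 [B2 mB2 <-]]; rewrite -setXI.
  exists (A1 `&` A2); first exact: measurableI.
  by exists (B1 `&` B2) => //; exact: measurableI.
- by exists setT => //; exists setT => //; rewrite setXTT.
- exact: rectangles_indep.
- by [].
- by move=> _ y; exact: expR_ge0.
- by move=> l; rewrite fineK.
Qed.

Lemma measurable_sum_centered_product i j :
  measurable_fun setT (fun w => \sum_l Z i j l w).
Proof. by apply: measurable_sum => l; exact: measurable_centered_product. Qed.

(** The condition on t makes the quadratic term at most half of the linear one. *)
Lemma centered_product_tail i j (t del : R) : 0 < t -> t <= t0 / 2 ->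
  t * c <= del / 2 ->
  (P [set w | del * p%:R < `|\sum_l Z i j l w|]%R <=
    (2 * expR (- (t * del / 2) * p%:R))%:E)%E.
Proof.
move=> t_gt0 tt0 tc.
apply: (le_trans (chernoff_two_sided (b := p%:R * (t ^+ 2 * c)) _ _ t_gt0 _)).
- exact: measurable_sum_centered_product.
- move=> u ut; rewrite -ut (real_normK (num_real u)).
  by apply: integral_expR_sum_centered_product; rewrite ut.
rewrite lee_fin ler_wpM2l// ler_expR.
have := ler_wpM2l (ltW t_gt0) tc => /(ler_wpM2l (ler0n R p)).
by rewrite expr2; lra.
Qed.

Lemma max_gram_eig_tail (k : nat) (t eps : R) :
  (0 < k)%N -> (k <= n)%N -> (0 < p)%N ->
  0 < t -> t <= t0 / 2 -> t * c <= eps / k%:R / 2 ->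
  (P [set w | eps < `|max_gram_eig k (random_matrix X w) / p%:R - 1|]%R <=
    ((n ^ 2)%:R * (2 * expR (- (t * (eps / k%:R) / 2) * p%:R)))%:E)%E.
Proof.
move=> k_gt0 kn p_gt0 t_gt0 tt0 tc; set del := eps / k%:R.
have p0 : 0 < p%:R :> R by rewrite ltr0n.
have k0 : 0 < k%:R :> R by rewrite ltr0n.
pose bad (ij : 'I_n * 'I_n) :=
  [set w | del * p%:R < `|\sum_l Z ij.1 ij.2 l w|].
(* The deviation event is covered by the n^2 events bad ij. *)
have mlt (f : T -> R) x : measurable_fun setT f -> measurable [set w | x < `|f w|].
  move=> mf; rewrite (_ : mkset _ =
    setT `&` (fun w => `|f w|) @^-1` `]x, +oo[%classic); last first.
    by rewrite setTI; apply/seteqP; split=> w /=; rewrite in_itv /= andbT.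
  have mnf : measurable_fun setT (fun w => `|f w|) by exact: measurableT_comp.
  by apply: mnf => //; exact: measurable_itv.
have mbad ij : measurable (bad ij).
  by apply: mlt; exact: measurable_sum_centered_product.
apply: (@le_trans _ _ (\sum_(ij : 'I_n * 'I_n) P (bad ij))%E).
  rewrite fsbig_seq ?index_enum_uniq//; apply: content_sub_fsum => //.
    apply: mlt; apply: measurable_funB => //; apply: measurable_funM => //.
    apply: measurable_max_gram_eig => // i j.
    rewrite (_ : (fun w => _) = X i j)//.
    by apply/funext => w; rewrite mxE.
  move=> w /= epsw; apply: contrapT => nbad; move: epsw; apply/negP.
  rewrite -leNgt -[X in _ - X](divff (lt0r_neq0 p0)) -mulrBl normrM normfV.
  rewrite (gtr0_norm p0) ler_pdivrMr//.
  have -> : eps * p%:R = k%:R * (del * p%:R).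
    by rewrite mulrA /del mulrCA divff ?lt0r_neq0// mulr1.
  apply: max_gram_eig_close => // i j.
  have : ~ bad (i, j) w by move=> bw; apply: nbad; exists (i, j) => //=; rewrite mem_index_enum.
  rewrite /bad /= => /negP; rewrite -leNgt; congr (`|_| <= _).
  rewrite /centered_product sumrB sumr_const card_ord.
  congr (_ - _); first by apply: eq_bigr => l _; rewrite !mxE.
  by case: (i == j); rewrite ?mulr1n ?mulr0n ?mul0rn.
apply: (@le_trans _ _ (\sum_(ij : 'I_n * 'I_n) (2 * expR (- (t * del / 2) * p%:R))%:E)%E).
  apply: lee_sum => ij _; exact: centered_product_tail.
by rewrite sumEFin lee_fin sumr_const card_prod card_ord -mulnn [leRHS]mulr_natl.
Qed.

End entry_products.

(** * Convergence in probability *)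

(** Eventually p >= (3 / c) ln n, so that the exponential is at most n^-3. *)
Lemma expR_decay_squeeze (R : realType) (p : nat -> nat) (c : R) : 0 < c ->
  (p n)%:R / ln (n%:R : R) @[n --> \oo] --> +oo ->
  \forall n \near \oo, (0 < p n)%N /\
    (n ^ 2)%:R * (2 * expR (- c * (p n)%:R)) <= 2 / n%:R.
Proof.
move=> c0 /cvgryPge/(_ (3 / c)) hp.
near=> n.
have n2 : (1 < n)%N by near: n; exact: nbhs_infty_gt.
have n0 : 0 < n%:R :> R by rewrite ltr0n (ltn_trans _ n2).
have ln0 : 0 < ln (n%:R : R) by rewrite ln_gt0// ltr1n.
have : 3 / c <= (p n)%:R / ln (n%:R : R) by near: n.
rewrite ler_pdivlMr// => pn.
have pn0 : 0 < (p n)%:R :> R.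
  by apply: lt_le_trans pn; rewrite mulr_gt0 ?divr_gt0.
split; first by rewrite -(ltr0n R).
have : expR (- c * (p n)%:R) <= n%:R ^- 3.
  rewrite -[X in _ <= X ^- 3]lnK ?posrE// -expRM_natl -expRN ler_expR mulNr lerN2.
  by rewrite [leRHS]mulrC -ler_pdivrMr// mulrAC.
rewrite -(ler_pM2l (_ : 0 < (n ^ 2)%:R * 2 :> R)); last first.
  by rewrite mulr_gt0// natrX exprn_gt0.
rewrite mulrA => /le_trans; apply.
by rewrite natrX le_eqVlt; apply/orP; left; apply/eqP; field; rewrite lt0r_neq0.
Unshelve. all: by end_near. Qed.

Theorem mainTheorem9 (R : realType) (k : nat) (hk : (1 <= k)%N)
    (d0 : measure_display) (T0 : measurableType d0) (P0 : probability T0 R)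
    (xi : {RV P0 >-> R})
    (xi_mean : ('E_P0[xi] = 0)%E)
    (xi_var : ('E_P0[fun w => (xi w ^+ 2)%R] = 1)%E)
    (xi_exp : exists t0 : R, 0 < t0 /\
      ('E_P0[fun w => expR (t0 * xi w ^+ 2)%R] < +oo)%E)
    (p : nat -> nat)
    (hp : (p n)%:R / ln (n%:R : R) @[n --> \oo] --> +oo)
    (d : nat -> measure_display) (T : forall n, measurableType (d n))
    (P : forall n, probability (T n) R)
    (X : forall n, 'I_(p n) -> 'I_n -> {RV (P n) >-> R})
    (X_law : forall n (i : 'I_(p n)) (j : 'I_n), same_law (X n i j) xi)
    (X_indep : forall n,
      mutually_independent (fun ij : 'I_(p n) * 'I_n => X n ij.1 ij.2)) :
  cvg_in_probability P
    (fun n w => max_gram_eig k (random_matrix (X n) w) / (p n)%:R) 1.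
Proof.
move: xi_mean xi_var xi_exp; rewrite unlock => xi_mean xi_var [t0 [t0_gt0 xi_fin]].
set E := (\int[P0]_w (expR (t0 * xi w ^+ 2))%:E)%E in xi_fin.
have E0 : (0 <= E)%E by apply: integral_ge0 => w _; rewrite lee_fin expR_ge0.
have xi_exp : E = (fine E)%:E by rewrite fineK// ge0_fin_numE.
move=> eps eps0; set c := 16 / t0 ^+ 2 * (expR t0 * fine E).
have k0 : 0 < k%:R :> R by rewrite ltr0n.
have c0 : 0 <= c.
  by rewrite !mulr_ge0 ?expR_ge0 ?invr_ge0 ?sqr_ge0 ?fine_ge0.
pose t := Num.min (t0 / 2) (eps / k%:R / 2 / (c + 1)).
have c1 : 0 < c + 1 by rewrite ltr_wpDl.
have t_gt0 : 0 < t by rewrite /t lt_min !divr_gt0.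
have tt0 : t <= t0 / 2 by rewrite /t ge_min lexx.
have tc : t * c <= eps / k%:R / 2.
  have : t * (c + 1) <= eps / k%:R / 2.
    by rewrite -ler_pdivlMr// /t ge_min lexx orbT.
  by apply: le_trans; rewrite ler_wpM2l ?(ltW t_gt0)// lerDl.
have rate : 0 < t * (eps / k%:R) / 2 by rewrite !(divr_gt0, mulr_gt0).
apply: (@squeeze_cvge _ _ _ _ (fun=> 0%E) _ (fun n => (2 / n%:R : R)%:E)).
- near=> n; apply/andP; split; first exact: measure_ge0.
  have kn : (k <= n)%N by near: n; exact: nbhs_infty_ge.
  have [pn0 bound] : (0 < p n)%N /\ (n ^ 2)%:R *
      (2 * expR (- (t * (eps / k%:R) / 2) * (p n)%:R)) <= 2 / n%:R.
    by near: n; exact: expR_decay_squeeze.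
  apply: (le_trans (max_gram_eig_tail (X_law n) (X_indep n) xi_mean xi_var
    t0_gt0 xi_exp hk kn pn0 t_gt0 tt0 tc)).
  by rewrite lee_fin.
- exact: cvg_cst.
- apply: cvg_EFin; first by near=> n.
  rewrite -[X in _ --> X](mulr0 (2 : R)); apply: cvgMr.
  apply/gtr0_cvgV0; last exact: cvgr_idn.
  by near=> n; rewrite ltr0n; near: n; exact: nbhs_infty_gt.
Unshelve. all: by end_near. Qed.
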